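(* Let $(\nabla,\ast,E)$ be a Saito structure on a complex manifold $M$ with unit $e$, let $\lambda\in\mathbb{C}$, put $\mathcal{U}_\lambda(x)=(E-\lambda e)\ast x$, and assume that $M_\lambda=\{p\in M\mid \mathcal{U}_\lambda \text{ is invertible on } T_pM\}$ is nonempty. On $TM_\lambda$ define $$x\star_\lambda y=\mathcal{U}_\lambda^{-1}(x\ast y),\qquad \boldsymbol{\nabla}^{(\lambda,0)}_xy=\nabla_xy-\nabla_{x\star_\lambda y}E.$$ Then $(M_\lambda,\nabla,\boldsymbol{\nabla}^{(\lambda,0)},\ast,\star_\lambda,e,E-\lambda e)$ is a bi-flat $F$-manifold.
   Context: Manifolds are complex manifolds, $\mathcal{T}_M$ is the sheaf of holomorphic vector fields, and a multiplication on $TM$ is an $\mathcal{O}_M$-bilinear map $\mathcal{T}_M\times\mathcal{T}_M\to\mathcal{T}_M$. A Saito structure $(\nabla,\ast,E)$ on $M$ consists of a torsion-free flat connection $\nabla$ on $TM$, an associative commutative multiplication $\ast$ with unit vector field $e$, and a vector field $E$ such that for all $x,y,z\in\mathcal{T}_M$: (SS1) $\nabla_x(y\ast z)-y\ast\nabla_xz-\nabla_y(x\ast z)+x\ast\nabla_yz=[x,y]\ast z$; (SS2) $[E,x\ast y]-[E,x]\ast y-x\ast[E,y]=x\ast y$; (SS3) $\nabla e=0$; (SS4) $\nabla_x\nabla_yE-\nabla_{\nabla_xy}E=0$. A bi-flat $F$-manifold $(M,\nabla,\boldsymbol{\nabla},\ast,\star,e,E)$ consists of a manifold $M$, torsion-free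 flat connections $\nabla,\boldsymbol{\nabla}$ on $TM$, and associative commutative multiplications $\ast$ and $\star$ on $TM$ with units $e$ and $E$ respectively, such that (SS1), (SS2), (SS3) hold and for all $x,y,z\in\mathcal{T}_M$: - $\boldsymbol{\nabla}_x(y\star z)-y\star\boldsymbol{\nabla}_xz-\boldsymbol{\nabla}_y(x\star z)+x\star\boldsymbol{\nabla}_yz=[x,y]\star z$; - $\boldsymbol{\nabla}E=0$; - the endomorphism $\mathcal{U}(x)=E\ast x$ of $\mathcal{T}_M$ is an isomorphism and $E\ast(x\star y)=x\ast y$; - $\boldsymbol{\nabla}_x(y\ast z)-\boldsymbol{\nabla}_y(x\ast z)=\nabla_x(y\ast z)-\nabla_y(x\ast z)$. *)

(* Defs.v *)
From HB Require Import structures.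
From mathcomp Require Import all_boot all_order all_algebra.
From mathcomp Require Import all_classical all_reals all_analysis.
From mathcomp Require Import complex.

Set Implicit Arguments.
Unset Strict Implicit.
Unset Printing Implicit Defensive.

Import Order.TTheory GRing.Theory Num.Theory.
Import numFieldNormedType.Exports.

Local Open Scope classical_set_scope.
Local Open Scope ring_scope.

(* The field R[i], typed so that its norm topology is inferred. *)
Definition cplx (R : realType) : numClosedFieldType := R[i].

(* Derivatives are taken over the field [cplx R], so [differentiable] means
   complex (Frechet) differentiable. [smooth_upto k W f]: on W, the complex
   directional derivatives of f of order < k are differentiable. *)
Fixpoint smooth_upto (R : realType) (n m : nat) (k : nat)
    (W : set 'rV[cplx R]_n) (f : 'rV[cplx R]_n -> 'rV[cplx R]_m) : Prop :=
  if k is k'.+1 then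
    (forall a, W a -> differentiable f a) /\
    (forall v, smooth_upto k' W ('D_v f))
  else True.

(* A complex manifold: a smooth manifold of complex dimension n with
   holomorphic transition maps. That complex derivatives of all orders exist
   is automatic for a complex differentiable map; it is recorded because a
   complex manifold is in particular a smooth manifold. *)
Record complex_manifold (R : realType) (n : nat) := ComplexManifold {
  carrier :> topologicalType;
  chart : Type;
  dom : chart -> set carrier;
  coord : chart -> carrier -> 'rV[cplx R]_n;
  param : chart -> 'rV[cplx R]_n -> carrier;
  carrier_hausdorff : hausdorff_space carrier;
  carrier_second_countable : @second_countable carrier;
  chart_cover : forall p, exists c, dom c p;
  dom_open : forall c, open (dom c);
  codom_open : forall c, open (coord c @` dom c);
  coord_continuous : forall c, {in dom c, continuous (coord c)};
  param_continuous : forall c, {in coord c @` dom c, continuous (param c)};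
  coordK : forall c, {in dom c, cancel (coord c) (param c)};
  transition_holomorphic : forall c d k,
    smooth_upto k (coord c @` (dom c `&` dom d)) (coord d \o param c)
}.

Section Fields.
Context (R : realType) (n : nat) (M : complex_manifold R n).
Local Notation C := (cplx R).
Implicit Types (U W : set M) (p q : M) (c d : chart M).

Definition chart_at p : chart M := projT1 (cid (chart_cover p)).

(* T_pM is identified with C^n by the coordinates of the preferred chart
   [chart_at p]. Vectors are rows and act on the left of jacobians. *)
Local Notation vfield := (M -> 'rV[C]_n).
Local Notation vfield_op := (vfield -> vfield -> vfield).

(* coordinate change T_pM -> C^n from the chart c to the chart d *)
Definition change_mx c d p : 'M[C]_n :=
  jacobian (coord d \o param c) (coord c p).

(* components of x in the chart c (meaningful on [dom c]) *)
Definition components c (x : vfield) : vfield :=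
  fun p => x p *m change_mx (chart_at p) c p.

Definition holo_fun U (f : M -> C) : Prop :=
  forall c p, U p -> dom c p ->
    differentiable (f \o param c : _ -> C^o) (coord c p).

Definition holo_vfield U (x : vfield) : Prop :=
  forall c p, U p -> dom c p ->
    differentiable (components c x \o param c) (coord c p).

(* Sections of T_M over U, as everywhere defined functions whose values
   outside U are irrelevant; equations between sections are stated on U. *)
Record section U := Section {
  section_fun :> vfield;
  section_holo : holo_vfield U section_fun
}.

Definition eq_on U (x y : vfield) : Prop := forall p, U p -> x p = y p.
Local Notation "x =[ U ]= y" := (eq_on U x y) (at level 70).

Definition null_field : vfield := fun=> 0.

Definition derivation (x : vfield) (f : M -> C) : M -> C := fun p =>
  let c := chart_at p in
  'D_(x p) (f \o param c : _ -> C^o) (coord c p).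

Definition scale_field (f : M -> C) (x : vfield) : vfield :=
  fun p => f p *: x p.

(* Lie bracket, computed in the preferred chart at each point *)
Definition bracket (x y : vfield) : vfield := fun p =>
  let c := chart_at p in
  'D_(x p) (components c y \o param c) (coord c p) -
  'D_(y p) (components c x \o param c) (coord c p).

(* The structures below live on an open submanifold W of M ([setT] for M
   itself): the tangent sheaf of W is the restriction of that of M, so its
   sections are sections over the open sets contained in W. *)
Definition open_submanifold W : Prop := open W /\ W !=set0.

Definition opens W : set (set M) := [set U | open U /\ U `<=` W].

(* A morphism of sheaves of sets T_W x T_W -> T_W: sections over any open U
   are sent to sections over U, and the result over U depends only on the
   restrictions to U of the arguments. *)
Definition sheaf_op W (B : vfield_op) : Prop :=
  forall U, opens W U ->
    (forall x y : section U, holo_vfield U (B x y)) /\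
    (forall x x' y y' : section U,
       x =[U]= x' -> y =[U]= y' -> B x y =[U]= B x' y').

Record multiplication W (m : vfield_op) : Prop := {
  mul_sheaf : sheaf_op W m;
  mul_linearl : forall U, opens W U -> forall (f : M -> C) (x x' y : section U),
    holo_fun U f ->
    m (scale_field f x + x') y =[U]= scale_field f (m x y) + m x' y;
  mul_linearr : forall U, opens W U -> forall (f : M -> C) (x y y' : section U),
    holo_fun U f ->
    m x (scale_field f y + y') =[U]= scale_field f (m x y) + m x y'
}.

Record comm_assoc_mul W (m : vfield_op) (e : vfield) : Prop := {
  cam_mul : multiplication W m;
  cam_assoc : forall U, opens W U -> forall x y z : section U,
    m (m x y) z =[U]= m x (m y z);
  cam_comm : forall U, opens W U -> forall x y : section U,
    m x y =[U]= m y x;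
  cam_unit_holo : holo_vfield W e;
  cam_unit : forall U, opens W U -> forall x : section U, m e x =[U]= x
}.

Record connection W (nabla : vfield_op) : Prop := {
  conn_sheaf : sheaf_op W nabla;
  conn_linear : forall U, opens W U -> forall (f : M -> C) (x x' y : section U),
    holo_fun U f ->
    nabla (scale_field f x + x') y =[U]=
      scale_field f (nabla x y) + nabla x' y;
  conn_additive : forall U, opens W U -> forall x y y' : section U,
    nabla x ((y : vfield) + y') =[U]= nabla x y + nabla x y';
  conn_leibniz : forall U, opens W U -> forall (f : M -> C) (x y : section U),
    holo_fun U f ->
    nabla x (scale_field f y) =[U]=
      scale_field (derivation x f) y + scale_field f (nabla x y)
}.

Definition torsion_free W (nabla : vfield_op) : Prop :=
  forall U, opens W U -> forall x y : section U,
    nabla x y - nabla y x =[U]= bracket x y.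

Definition flat W (nabla : vfield_op) : Prop :=
  forall U, opens W U -> forall x y z : section U,
    nabla x (nabla y z) - nabla y (nabla x z) =[U]= nabla (bracket x y) z.

Record torsion_free_flat W (nabla : vfield_op) : Prop := {
  tff_connection : connection W nabla;
  tff_torsion_free : torsion_free W nabla;
  tff_flat : flat W nabla
}.

Definition potentiality W (nabla m : vfield_op) : Prop :=
  forall U, opens W U -> forall x y z : section U,
    nabla x (m y z) - m y (nabla x z) - nabla y (m x z) + m x (nabla y z)
      =[U]= m (bracket x y) z.

Definition euler W (m : vfield_op) (E : vfield) : Prop :=
  forall U, opens W U -> forall x y : section U,
    bracket E (m x y) - m (bracket E x) y - m x (bracket E y) =[U]= m x y.

Definition parallel W (nabla : vfield_op) (e : vfield) : Prop :=
  forall U, opens W U -> forall x : section U, nabla x e =[U]= null_field.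

Record saito_structure W (nabla m : vfield_op)
    (e E : vfield) : Prop := {
  saito_submanifold : open_submanifold W;
  saito_nabla : torsion_free_flat W nabla;
  saito_mul : comm_assoc_mul W m e;
  saito_euler_holo : holo_vfield W E;
  saito_SS1 : potentiality W nabla m;
  saito_SS2 : euler W m E;
  saito_SS3 : parallel W nabla e;
  saito_SS4 : forall U, opens W U -> forall x y : section U,
    nabla x (nabla y E) - nabla (nabla x y) E =[U]= null_field
}.

(* An endomorphism of the sheaf T_W is an isomorphism iff it is bijective on
   the sections over every open set. *)
Definition sheaf_iso W (F : vfield -> vfield) : Prop :=
  forall U, opens W U ->
    (forall x x' : section U, F x =[U]= F x' -> x =[U]= x') /\
    (forall y : section U, exists x : section U, F x =[U]= y).

Record biflat_F_manifold W (nabla nabla' m m' : vfield_op)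
    (e E : vfield) : Prop := {
  biflat_submanifold : open_submanifold W;
  biflat_nabla : torsion_free_flat W nabla;
  biflat_nabla' : torsion_free_flat W nabla';
  biflat_mul : comm_assoc_mul W m e;
  biflat_mul' : comm_assoc_mul W m' E;
  biflat_SS1 : potentiality W nabla m;
  biflat_SS2 : euler W m E;
  biflat_SS3 : parallel W nabla e;
  biflat_SS1' : potentiality W nabla' m';
  biflat_SS3' : parallel W nabla' E;
  biflat_iso : sheaf_iso W (m E);
  biflat_mul_mul' : forall U, opens W U -> forall x y : section U,
    m E (m' x y) =[U]= m x y;
  biflat_compat : forall U, opens W U -> forall x y z : section U,
    nabla' x (m y z) - nabla' y (m x z) =[U]=
      nabla x (m y z) - nabla y (m x z)
}.

(* the vector v of T_pM extended to [dom (chart_at p)] with constant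
   components in the chart [chart_at p] *)
Definition extend p (v : 'rV[C]_n) : vfield :=
  fun q => v *m change_mx (chart_at p) (chart_at q) q.

(* The endomorphism of T_pM induced by an O_M-linear F, as a matrix acting on
   rows: v |-> F(x)(p) for a local section x with x(p) = v. By O_M-linearity
   the choice of x does not matter. *)
Definition fibre_mx (F : vfield -> vfield) p : 'M[C]_n :=
  lin1_mx (fun v => F (extend p v) p).

Definition shift_field (E e : vfield) (lambda : C) : vfield :=
  fun p => E p - lambda *: e p.

Definition U_lambda (m : vfield_op) (e E : vfield)
    (lambda : C) : vfield -> vfield := m (shift_field E e lambda).

Definition M_lambda (m : vfield_op) (e E : vfield)
    (lambda : C) : set M :=
  [set p | fibre_mx (U_lambda m e E lambda) p \in unitmx].

Definition star_lambda (m : vfield_op) (e E : vfield)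
    (lambda : C) (x y : vfield) : vfield :=
  fun p => m x y p *m invmx (fibre_mx (U_lambda m e E lambda) p).

Definition nabla_lambda (nabla m : vfield_op) (e E : vfield)
    (lambda : C) (x y : vfield) : vfield :=
  nabla x y - nabla (star_lambda m e E lambda x y) E.

End Fields.

(* Main.v *)
Require Import Defs.
From HB Require Import structures.
From mathcomp Require Import all_boot all_order all_algebra.
From mathcomp Require Import all_classical all_reals all_analysis.
From mathcomp Require Import complex.
From mathcomp Require Import ring.
(* [coord] also names coordinates in a basis of a vector space; below it is the
   coordinate map of a chart. *)
Import Defs.

(** Write F = E - lambda e, D x = nabla_x E and W = M_lambda, and consider the
    sections over an open U inside W.

    Geometry. A multiplication is O-linear, so in the frame of a chart the
    endomorphism F * _ is a holomorphic matrix, and its value at p acts on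
    T_pM (lemma [mul_fibre]). Its determinant is continuous, so W is open, and
    by the cofactor formula its inverse is holomorphic, so that
    G = U_lambda^-1(e) is a holomorphic field on W with F * G = e; moreover
    x star y = G * x * y.

    Algebra. The sections over U form a commutative ring under *, with unit e,
    in which multiplying by a function f means multiplying by f e, and the
    connection is a biadditive operation on this ring. The shift by lambda e is
    harmless, because nabla commutes with multiplication by lambda e: hence F
    satisfies the axioms of E, with the same D ([saito_ring_shift]). Now (SS1)
    for the pair (x, F), combined with (SS2), gives [nabla_mulE]:

      nabla_x (F w) = F nabla_x w + D (x w) - x D w + x w.

    Substituting z = F w in (SS1) then yields [star_potentiality]:

      nabla_x (y star z) - y star nabla_x z - nabla_y (x star z)
        + x star nabla_y z
      = [x, y] star z + x star D (y star z) - y star D (x star z).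

    For nabla' _x y = nabla_x y - D (x star y) the correction terms in D
    cancel the last two terms, which is the potentiality of nabla'. Applying D
    to the same identity, and commuting D with nabla by (SS4), gives the
    flatness of nabla'. The other axioms follow from the commutativity of the
    two multiplications and from F * G = e. *)

Set Implicit Arguments.
Unset Strict Implicit.
Unset Printing Implicit Defensive.

Import Order.TTheory GRing.Theory Num.Theory.
Import numFieldNormedType.Exports.

Local Open Scope classical_set_scope.
Local Open Scope ring_scope.

(** * Saito structures on commutative rings *)

(** These two lemmas let [ring] derive an equation from a linear combination
    of known equations, by giving the coefficients. *)
Lemma eq_lin1 (A : pzRingType) (c a b x y : A) :
  a = b -> x - y = c * (a - b) -> x = y.
Proof. by move=> ->; rewrite subrr mulr0 => /subr0_eq. Qed.

Lemma eq_lin2 (A : pzRingType) (c c' a b a' b' x y : A) :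
  a = b -> a' = b' -> x - y = c * (a - b) + c' * (a' - b') -> x = y.
Proof. by move=> -> ->; rewrite !subrr !mulr0 addr0 => /subr0_eq. Qed.

(** The axioms of a Saito structure, read on a ring of sections: * is the
    product, e is 1, and the Lie bracket [x, y] is spelled
    nabla_x y - nabla_y x, as the connection is torsion-free. *)
Record saito_ring (A : comPzRingType) (nabla : A -> A -> A) (E : A) : Prop := {
  nablaBl : forall x x' y, nabla (x - x') y = nabla x y - nabla x' y;
  nablaBr : forall x y y', nabla x (y - y') = nabla x y - nabla x y';
  nabla_flat : forall x y z, nabla x (nabla y z) - nabla y (nabla x z) =
    nabla (nabla x y - nabla y x) z;
  ring_SS1 : forall x y z,
    nabla x (y * z) - y * nabla x z - nabla y (x * z) + x * nabla y z =
    (nabla x y - nabla y x) * z;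
  ring_SS2 : forall x y,
    (nabla E (x * y) - nabla (x * y) E) - (nabla E x - nabla x E) * y
      - x * (nabla E y - nabla y E) = x * y;
  ring_SS3 : forall x, nabla x 1 = 0;
  ring_SS4 : forall x y, nabla x (nabla y E) = nabla (nabla x y) E
}.

Section SaitoRing.
Context (A : comPzRingType) (nabla : A -> A -> A).

Lemma nabla0l E : saito_ring nabla E -> forall y, nabla 0 y = 0.
Proof. by move=> S y; have := nablaBl S 0 0 y; rewrite !subrr. Qed.

Lemma nablaNl E : saito_ring nabla E ->
  forall x y, nabla (- x) y = - nabla x y.
Proof. by move=> S x y; rewrite -sub0r (nablaBl S) (nabla0l S) sub0r. Qed.

Lemma nablaDl E : saito_ring nabla E ->
  forall x x' y, nabla (x + x') y = nabla x y + nabla x' y.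
Proof.
by move=> S x x' y; rewrite -[in LHS](opprK x') (nablaBl S) (nablaNl S) opprK.
Qed.

Lemma nablaDr E : saito_ring nabla E ->
  forall x y y', nabla x (y + y') = nabla x y + nabla x y'.
Proof.
by move=> S x y y'; apply/eqP; rewrite -subr_eq -(nablaBr S) addrK.
Qed.

Section Shift.
Context (E l : A).
Hypothesis S : saito_ring nabla E.
Hypothesis l_const : forall x y, nabla x (l * y) = l * nabla x y.

Lemma nabla_shift x : nabla x (E - l) = nabla x E.
Proof.
by rewrite (nablaBr S) -[l]mulr1 l_const (ring_SS3 S) mulr0 subr0.
Qed.

(** For (SS2) the contribution of l must vanish, that is, [l, _] must be a
    derivation of the product; this is (SS1) for l, x and y. *)
Lemma saito_ring_shift : saito_ring nabla (E - l).
Proof.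
split; [exact: nablaBl S | exact: nablaBr S | exact: nabla_flat S
       | exact: ring_SS1 S | | exact: ring_SS3 S |]; last first.
  by move=> x y; rewrite !nabla_shift (ring_SS4 S).
move=> x y; rewrite !nabla_shift !(nablaBl S).
have nl z : nabla z l = 0 by rewrite -[l]mulr1 l_const (ring_SS3 S) mulr0.
have := ring_SS1 S l x y; rewrite nl l_const => H1.
have := ring_SS2 S x y => H2.
apply: (eq_lin2 (c := 1) (c' := -1) H2 H1); ring.
Qed.

End Shift.

Section Inverse.
Context (E G : A).
Hypothesis S : saito_ring nabla E.
Hypothesis EG : E * G = 1.

Local Notation D x := (nabla x E).

(** (SS1) for x, E and w, plus (SS2) for x and w, in which D w appears as
    nabla_E w - [E, w]. *)
Lemma nabla_mulE x w :
  nabla x (E * w) = E * nabla x w + D (x * w) - x * D w + x * w.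
Proof.
have H1 := ring_SS1 S x E w.
have H2 := ring_SS2 S x w.
apply: (eq_lin2 (c := 1) (c' := 1) H1 H2); ring.
Qed.

(** With z = E w the stars of x and y with z become x w and y w. Then (SS1)
    for x, y, w and [nabla_mulE] for nabla_x (E w) and nabla_y (E w) leave
    only the terms in D on the right, because y (x (D w - w)) is symmetric in
    x and y. *)
Lemma star_potentiality x y z :
  nabla x (G * (y * z)) - G * (y * nabla x z) - nabla y (G * (x * z))
    + G * (x * nabla y z) =
  G * ((nabla x y - nabla y x) * z) + G * (x * D (G * (y * z)))
    - G * (y * D (G * (x * z))).
Proof.
have -> : z = E * (G * z) by rewrite mulrA EG mul1r.
set w := G * z.
have cancelE u : G * (u * (E * w)) = u * w.
  by apply: (eq_lin1 (c := u * w) EG); ring.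
rewrite !cancelE !nabla_mulE.
have H1 := ring_SS1 S x y w.
(* the second coefficient collects the terms multiplied by G * E *)
apply: (eq_lin2 (c := 1) (c' := x * nabla y w - y * nabla x w) H1 EG); ring.
Qed.

Definition nabla_star x y := nabla x y - D (G * (x * y)).

(** The curvature of [nabla_star] is the curvature of nabla minus D applied to
    [star_potentiality]: (SS4) turns nabla_x (D u) into D (nabla_x u). *)
Lemma star_flat x y z :
  nabla_star x (nabla_star y z) - nabla_star y (nabla_star x z) =
  nabla_star (nabla x y - nabla y x) z.
Proof.
rewrite /nabla_star !(nablaBr S) !(ring_SS4 S) !mulrBr !(nablaBl S).
have H1 := nabla_flat S x y z.
have := congr1 (fun t => D t) (star_potentiality x y z).
rewrite !(nablaDl S, nablaNl S) => H2.
move: H1; rewrite !(nablaBl S) => H1.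
apply: (eq_lin2 (c := 1) (c' := -1) H1 H2); ring.
Qed.

Lemma star_SS1 x y z :
  nabla_star x (G * (y * z)) - G * (y * nabla_star x z)
    - nabla_star y (G * (x * z)) + G * (x * nabla_star y z) =
  G * ((nabla x y - nabla y x) * z).
Proof.
have H := star_potentiality x y z; rewrite /nabla_star.
rewrite [y * (G * _)]mulrCA [y * (x * z)]mulrCA -[x * (G * (y * z))]mulrCA.
apply: (eq_lin1 (c := 1) H); ring.
Qed.

End Inverse.
End SaitoRing.

(** * Differentiability of matrix-valued functions *)

Lemma unitmx_det (K : fieldType) m (A : 'M[K]_m) :
  (A \in unitmx) = (\det A != 0).
Proof. by rewrite unitmxE unitfE. Qed.

Section Differentiability.
Context (K : numFieldType).

Lemma near_eq_diff (V W : normedModType K) (f g : V -> W) a :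
  (\near a, f a = g a) -> differentiable f a ->
  'd g a = 'd f a :> (V -> W) /\ differentiable g a.
Proof.
move=> fg /diff_locallyP[dc fE].
have fga : f a = g a by exact: nbhs_singleton fg.
have gE : g \o shift a = cst (g a) + 'd f a +o_ 0 id.
  apply/eqaddoP => eps eps0; move/eqaddoP: fE => /(_ eps eps0).
  have fg0 : \forall h \near 0, f (h + a) = g (h + a).
    by have := fg; rewrite (near_shift 0 a) subr0.
  apply: filterS2 fg0 => h fgh /=.
  by rewrite /= !fctE /= fgh fga.
have dE := diff_unique dc gE.
by split => //; apply/diff_locallyP; rewrite dE; split.
Qed.

Lemma near_eq_differentiable (V W : normedModType K) (f g : V -> W) a :
  (\forall t \near a, f t = g t) -> differentiable f a -> differentiable g a.
Proof. by move=> fg df; have [] := near_eq_diff fg df. Qed.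

Lemma differentiable_bigsum (V W : normedModType K) (I : Type) (r : seq I)
    (P : pred I) (f : I -> V -> W) a :
  (forall i, differentiable (f i) a) ->
  differentiable (fun t => \sum_(i <- r | P i) f i t) a.
Proof.
move=> df; rewrite -[X in differentiable X _]fct_sumE.
elim/big_ind: _ => [|g h dg dh|i _].
- exact: (differentiable_cst (0 : W) a).
- exact: differentiableD.
- exact: df.
Qed.

Lemma differentiable_bigprod (V : normedModType K) (I : Type) (r : seq I)
    (P : pred I) (f : I -> V -> K) a :
  (forall i, differentiable (f i) a) ->
  differentiable (fun t => \prod_(i <- r | P i) f i t) a.
Proof.
move=> df; elim: r => [|i r IHr].
  under eq_fun do rewrite big_nil.
  exact: (differentiable_cst (1 : K) a).
under eq_fun do rewrite big_cons.
by case: (P i); [exact: differentiableM|].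
Qed.

(** The determinant is a polynomial in the entries, by Leibniz's formula. *)
Lemma differentiable_det (V : normedModType K) m (A : V -> 'M[K]_m) a :
  (forall i j, differentiable (fun t => A t i j : K) a) ->
  differentiable (fun t => \det (A t) : K) a.
Proof.
move=> dA; apply: differentiable_bigsum => s.
by apply: differentiableZ; apply: differentiable_bigprod.
Qed.

Lemma differentiable_mx (V : normedModType K) m n (f : V -> 'M[K]_(m, n)) a :
  (forall i j, differentiable (fun t => f t i j : K) a) -> differentiable f a.
Proof.
move=> df; rewrite (_ : f = fun t => \sum_i \sum_j f t i j *: delta_mx i j).
  apply: differentiable_bigsum => i; apply: differentiable_bigsum => j.
  exact: differentiableZl.
by apply/funext => t; exact: matrix_sum_delta.
Qed.

Lemma differentiable_entry (V : normedModType K) m n (f : V -> 'M[K]_(m, n)) a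
    i j :
  differentiable f a -> differentiable (fun t => f t i j : K) a.
Proof.
move=> df.
exact: (differentiable_comp df (differentiable_coord (f a) i j)).
Qed.

Lemma differentiable_mulmx (V : normedModType K) m n p
    (f : V -> 'M[K]_(m, n)) (g : V -> 'M[K]_(n, p)) a :
  differentiable f a -> differentiable g a ->
  differentiable (fun t => f t *m g t) a.
Proof.
move=> df dg; apply: differentiable_mx => i j.
under eq_fun do rewrite mxE.
apply: differentiable_bigsum => k.
by apply: differentiableM; exact: differentiable_entry.
Qed.

(** Cramer's rule. *)
Lemma differentiable_invmx (V : normedModType K) m (A : V -> 'M[K]_m) a :
  (\near a, A a \in unitmx) -> differentiable A a ->
  differentiable (fun t => invmx (A t)) a.
Proof.
move=> uA dA; have uAa := nbhs_singleton uA.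
apply: (@near_eq_differentiable _ _
  (fun t => (\det (A t))^-1 *: \adj (A t))).
  by apply: filterS uA => t uAt; rewrite /invmx uAt.
apply: differentiable_mx => i j; under eq_fun do rewrite !mxE.
have dE i' j' : differentiable (fun t => A t i' j' : K) a.
  exact: differentiable_entry.
apply: differentiableM.
  apply: differentiableV; first exact: differentiable_det.
  by rewrite -unitfE.
rewrite /cofactor; apply: differentiableZ.
apply: differentiable_det => i' j'; under eq_fun do rewrite !mxE.
exact: dE.
Qed.

Lemma near_neq0 (T : topologicalType) (f : T -> K) a :
  {for a, continuous f} -> f a != 0 -> \forall t \near a, f t != 0.
Proof.
move=> cf fa; apply: (cf [set y | y != 0]).
apply: open_nbhs_nbhs; split => //.
rewrite (_ : [set y | y != 0] = ~` [set 0]); last first.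
  by apply/seteqP; split => y /= /eqP.
rewrite openC; apply: accessible_closed_set1; apply: hausdorff_accessible.
exact: norm_hausdorff.
Qed.

End Differentiability.

(** * Holomorphic vector fields and coordinate frames *)

Section Manifold.
Context (R : realType) (n : nat) (M : complex_manifold R n).
Local Notation C := (cplx R).
Implicit Types (U W : set M) (p q : M) (c d : chart M).
Local Notation vfield := (M -> 'rV[C]_n).

Lemma dom_chart_at p : dom (chart_at p) p.
Proof. exact: projT2 (cid (chart_cover p)). Qed.

Lemma near_dom c p : dom c p -> \forall q \near p, dom c q.
Proof. by move=> cp; apply: open_nbhs_nbhs; split => //; exact: dom_open. Qed.

Lemma near_param c p (P : set M) : dom c p ->
  (\forall q \near p, P q) -> \forall a \near coord c p, P (param c a).
Proof.
move=> cp Pp; have cont := @param_continuous _ _ _ c (coord c p) _.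
apply: cont; first by apply/mem_set; exists p.
by rewrite coordK ?inE.
Qed.

Lemma near_coord_param c p : dom c p ->
  \forall a \near coord c p, coord c (param c a) = a.
Proof.
move=> cp; have : nbhs (coord c p) (coord c @` dom c).
  by apply: open_nbhs_nbhs; split; [exact: codom_open|exists p].
by apply: filterS => _ [q cq <-]; rewrite coordK ?inE.
Qed.

Lemma differentiable_transition c d p : dom c p -> dom d p ->
  differentiable (coord d \o param c) (coord c p).
Proof.
move=> cp dp; have [+ _] := @transition_holomorphic _ _ M c d 1.
by apply; exists p.
Qed.

(** In this form the chain rule applies to the coordinate changes. *)
Lemma change_mxE c d p v : dom c p -> dom d p ->
  v *m change_mx c d p = 'd (coord d \o param c) (coord c p) v.
Proof.
move=> cp dp; rewrite -deriveE; last exact: differentiable_transition.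
by rewrite deriveEjacobian //; exact: differentiable_transition.
Qed.

(* Unfolding [change_mx] sends unification into the definition of the
   differential. *)
Local Opaque change_mx.

Lemma change_mx_trans c d d' p : dom c p -> dom d p -> dom d' p ->
  change_mx c d p *m change_mx d d' p = change_mx c d' p.
Proof.
move=> cp dp d'p; apply/row_matrixP => i; rewrite !rowE mulmxA.
have E1 := change_mxE (delta_mx 0 i) cp dp.
have E2 v := change_mxE v dp d'p.
have E3 := change_mxE (delta_mx 0 i) cp d'p.
rewrite [RHS]E3 [X in X *m _]E1 [LHS]E2.
have pK : param c (coord c p) = p by rewrite coordK ?inE.
have tr := differentiable_transition cp dp.
have tr' : differentiable (coord d' \o param d)
    ((coord d \o param c) (coord c p)).
  by rewrite /= pK; exact: differentiable_transition.
have [||E _] := @near_eq_diff _ _ _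
  ((coord d' \o param d) \o (coord d \o param c)) (coord d' \o param c)
  (coord c p).
- have := near_param cp (near_dom dp); apply: filterS => a da /=.
  by rewrite coordK ?inE.
- exact: differentiable_comp tr tr'.
rewrite [RHS](congr1 (@^~ (delta_mx 0 i)) E).
have := congr1 (@^~ (delta_mx 0 i)) (diff_comp tr tr').
by rewrite /= pK => D; exact: esym D.
Qed.

Lemma change_mx_id c p : dom c p -> change_mx c c p = 1%:M.
Proof.
move=> cp; apply/row_matrixP => i; rewrite !rowE (change_mxE _ cp cp) mulmx1.
have [||-> _] := @near_eq_diff _ _ _ id (coord c \o param c) (coord c p).
- by apply: filterS (near_coord_param cp) => a /= ->.
- by [].
by rewrite diff_val.
Qed.

Lemma componentsK c (x : vfield) p : dom c p ->
  components c x p *m change_mx c (chart_at p) p = x p.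
Proof.
move=> cp; have h := dom_chart_at p.
by rewrite /components -mulmxA change_mx_trans // change_mx_id // mulmx1.
Qed.

Lemma holo_vfield_eq U (x y : vfield) : open U -> eq_on U x y ->
  holo_vfield U x -> holo_vfield U y.
Proof.
move=> oU xy hx c p Up cp; apply: near_eq_differentiable (hx c p Up cp).
have Un : \forall q \near p, U q by exact: open_nbhs_nbhs.
apply: filterS (near_param cp Un) => a Ua /=.
by rewrite /components xy.
Qed.

Lemma holo_vfield_sub U U' (x : vfield) : U' `<=` U ->
  holo_vfield U x -> holo_vfield U' x.
Proof. by move=> sub hx c p /sub; exact: hx. Qed.

Lemma holo_vfieldD U (x y : vfield) :
  holo_vfield U x -> holo_vfield U y -> holo_vfield U (x + y).
Proof.
move=> hx hy c p Up cp.
have -> : components c (x + y) \o param c =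
    (components c x \o param c) + (components c y \o param c).
  by apply/funext => a; rewrite /components /= !fctE mulmxDl.
by apply: differentiableD; [exact: hx|exact: hy].
Qed.

Lemma holo_vfield_scale U (f : M -> C) (x : vfield) :
  holo_fun U f -> holo_vfield U x -> holo_vfield U (scale_field f x).
Proof.
move=> hf hx c p Up cp; apply: differentiable_mx => i j.
have -> : (fun t => (components c (scale_field f x) \o param c) t i j : C) =
    (f \o param c) * (fun t => (components c x \o param c) t i j : C).
  apply/funext => t; rewrite /components /scale_field /=.
  by rewrite -scalemxAl mxE.
apply: differentiableM; first exact: hf.
by apply: differentiable_entry; exact: hx.
Qed.

Lemma holo_fun_cst U (k : C) : holo_fun U (fun=> k).
Proof. by move=> c p _ _; exact: (differentiable_cst (k : C^o) _). Qed.

Lemma holo_vfieldN U (x : vfield) : holo_vfield U x -> holo_vfield U (- x).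
Proof.
move=> hx; have := holo_vfield_scale (@holo_fun_cst U (-1)) hx.
rewrite (_ : scale_field _ _ = - x) //.
by apply/funext => p; rewrite /scale_field scaleN1r.
Qed.

Lemma holo_shift_field U (E e : vfield) (lambda : C) :
  holo_vfield U E -> holo_vfield U e -> holo_vfield U (shift_field E e lambda).
Proof.
move=> hE he; rewrite (_ : shift_field _ _ _ =
  E + - scale_field (fun=> lambda) e :> vfield) //.
apply: holo_vfieldD => //; apply: holo_vfieldN; apply: holo_vfield_scale => //.
exact: holo_fun_cst.
Qed.

Lemma holo_vfield0 U : holo_vfield U 0.
Proof.
move=> c p _ _.
rewrite (_ : _ \o _ = cst 0); first exact: differentiable_cst.
by apply/funext => a; exact: mul0mx.
Qed.

(** The field on [dom c] with constant components v in the chart c; [extend p v]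
    is the case [c = chart_at p]. *)
Definition frame c (v : 'rV[C]_n) : vfield :=
  fun q => v *m change_mx c (chart_at q) q.

Lemma components_frame c d v p : dom c p -> dom d p ->
  components d (frame c v) p = v *m change_mx c d p.
Proof.
move=> cp dp; have h := dom_chart_at p.
by rewrite /components /frame -mulmxA change_mx_trans.
Qed.

(** In a chart d the components of the field are the derivative of the
    transition map from c to d in the constant direction v, so this uses that
    first derivatives of transition maps are holomorphic. *)
Lemma holo_frame c v : holo_vfield (dom c) (frame c v).
Proof.
move=> d p cp dp; have pK : param d (coord d p) = p by rewrite coordK ?inE.
have [_ /(_ v)[+ _]] := @transition_holomorphic _ _ M c d 2.
move=> /(_ (coord c p)) dD.
have {}dD : differentiable ('D_v (coord d \o param c)) (coord c p).
  by apply: dD; exists p.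
apply: (@near_eq_differentiable _ _ _
    ('D_v (coord d \o param c) \o (coord c \o param d))); last first.
  apply: (differentiable_comp (differentiable_transition dp cp)).
  by rewrite /= pK.
have dn := near_param dp (near_dom cp).
have dn' := near_param dp (near_dom dp).
apply: filterS2 dn dn' => a ca da /=.
rewrite [RHS](components_frame v ca da) [RHS](change_mxE v ca da).
exact: deriveE (differentiable_transition ca da).
Qed.

Lemma holo_fun_components U c (x : vfield) i :
  open U -> U `<=` dom c -> holo_vfield U x ->
  holo_fun U (fun q => components c x q 0 i).
Proof.
move=> oU Uc hx d p Up dp; have cp := Uc p Up.
have pK : param d (coord d p) = p by rewrite coordK ?inE.
apply: (@near_eq_differentiable _ _ _
    ((fun t => (components c x \o param c) t 0 i : C) \o (coord c \o param d)));
  last first.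
  apply: (differentiable_comp (differentiable_transition dp cp)).
  by rewrite /= pK; apply: differentiable_entry; exact: hx.
have dn := near_param dp (near_dom cp).
by apply: filterS dn => a ca /=; rewrite coordK ?inE.
Qed.

End Manifold.

(** * The endomorphism given by multiplication by a field *)

Section MulEndomorphism.
Context (R : realType) (n : nat) (M : complex_manifold R n).
Local Notation C := (cplx R).
Implicit Types (U : set M) (p q : M) (c d : chart M).
Local Notation vfield := (M -> 'rV[C]_n).
Context (m : vfield -> vfield -> vfield) (F : vfield).
Hypothesis m_mul : multiplication [set: M] m.
Hypothesis F_holo : holo_vfield [set: M] F.

Local Notation fib := (fibre_mx (m F)).

Let opensT U : open U -> opens [set: M] U.
Proof. by []. Qed.

Let F_holo_on U : holo_vfield U F.
Proof. exact: holo_vfield_sub F_holo. Qed.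

Lemma mul_holo U x : open U -> holo_vfield U x -> holo_vfield U (m F x).
Proof.
move=> oU hx; have [h _] := mul_sheaf m_mul (opensT oU).
exact: h (Section (@F_holo_on U)) (Section hx).
Qed.

Lemma mul_local U x y : open U -> holo_vfield U x -> holo_vfield U y ->
  eq_on U x y -> eq_on U (m F x) (m F y).
Proof.
move=> oU hx hy xy; have [_ h] := mul_sheaf m_mul (opensT oU).
exact: h (Section (@F_holo_on U)) (Section (@F_holo_on U)) (Section hx)
  (Section hy) _ xy.
Qed.

Lemma mul_lin U f x y : open U -> holo_fun U f -> holo_vfield U x ->
  holo_vfield U y ->
  eq_on U (m F (scale_field f x + y)) (scale_field f (m F x) + m F y).
Proof.
move=> oU hf hx hy.
exact: (mul_linearr m_mul (opensT oU) (Section (@F_holo_on U)) (Section hx)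
  (Section hy) hf).
Qed.

(** The linearity axiom gives m F 0 = 0, the empty sum, as m F 0 is its own
    double. *)
Lemma mul_sum U (I : Type) (r : seq I) (f : I -> M -> C) (X : I -> vfield) :
  open U -> (forall i, holo_fun U (f i)) -> (forall i, holo_vfield U (X i)) ->
  eq_on U (m F (\sum_(i <- r) scale_field (f i) (X i)))
    (\sum_(i <- r) scale_field (f i) (m F (X i))).
Proof.
move=> oU hf hX p Up; elim: r => [|i r IHr].
  rewrite !big_nil.
  have h0 := @holo_vfield0 _ _ M U.
  have := mul_lin oU (@holo_fun_cst _ _ M U 1) h0 h0 Up.
  have -> : scale_field (fun=> 1) 0 + 0 = 0 :> vfield.
    by apply/funext => q; rewrite /scale_field addr0 scale1r.
  rewrite [X in _ = X -> _]/(_ + _) /scale_field scale1r => /esym/eqP.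
  by rewrite -subr_eq0 addrK => /eqP.
rewrite !big_cons.
have hs : holo_vfield U (\sum_(j <- r) scale_field (f j) (X j)).
  elim/big_ind: _ => [|x y|j _]; [exact: holo_vfield0|exact: holo_vfieldD|].
  exact: holo_vfield_scale.
rewrite (mul_lin oU (hf i) (hX i) hs Up).
by congr (_ + _); rewrite IHr.
Qed.

Lemma frame_decomposition c (x : vfield) :
  eq_on (dom c) x
    (\sum_i scale_field (fun q => components c x q 0 i)
       (frame c (delta_mx 0 i))).
Proof.
move=> q cq; rewrite -[LHS](componentsK x cq).
rewrite [X in X *m _]row_sum_delta mulmx_suml fct_sumE.
by apply: eq_bigr => i _; rewrite /scale_field /frame -scalemxAl.
Qed.

(** Decompose x in the frame of [chart_at p] and use O-linearity: at p only
    the values of the coefficients, which are the entries of x p, remain. *)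
Lemma mul_fibre U (x : vfield) p : open U -> holo_vfield U x -> U p ->
  m F x p = x p *m fib p.
Proof.
move=> oU hx Up; set c := chart_at p.
have cp : dom c p := dom_chart_at p.
pose U' := U `&` dom c.
have oU' : open U' by apply: openI => //; exact: dom_open.
have U'p : U' p by [].
have hx' : holo_vfield U' x by apply: holo_vfield_sub hx => ? [].
have hf i : holo_fun U' (fun q => components c x q 0 i).
  by apply: holo_fun_components => // ? [].
have hX i : holo_vfield U' (frame c (delta_mx 0 i)).
  by apply: holo_vfield_sub (@holo_frame _ _ _ c _) => ? [].
have dec : eq_on U' x
    (\sum_i scale_field (fun q => components c x q 0 i)
       (frame c (delta_mx 0 i))).
  by move=> q [_ cq]; exact: frame_decomposition.
rewrite (mul_local oU' hx' (holo_vfield_eq oU' dec hx') dec U'p).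
rewrite (mul_sum _ oU' hf hX U'p) fct_sumE mulmx_sum_row.
apply: eq_bigr => i _; rewrite /scale_field /components change_mx_id // mulmx1.
by congr (_ *: _); apply/rowP => j; rewrite !mxE.
Qed.

(** The fibre matrices are expressed in the preferred charts, whose choice
    at different points is unrelated; only after conjugation into a fixed chart
    do they depend holomorphically on it. *)
Definition chart_mx c p : 'M[C]_n :=
  change_mx c (chart_at p) p *m fib p *m change_mx (chart_at p) c p.

Lemma differentiable_chart_mx c p : dom c p ->
  differentiable (chart_mx c \o param c) (coord c p).
Proof.
move=> cp; apply: differentiable_mx => i j.
have oc := dom_open c.
have hX := @holo_frame _ _ M c (delta_mx 0 i).
have hm := mul_holo oc hX.
apply: (@near_eq_differentiable _ _ _
  (fun t => (components c (m F (frame c (delta_mx 0 i))) \o param c) t 0 j : C)).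
  have dn := near_param cp (near_dom cp).
  apply: filterS dn => a ca /=.
  rewrite /components (mul_fibre oc hX ca) /frame /chart_mx.
  by rewrite -!mulmxA -rowE [LHS]mxE.
by apply: differentiable_entry; exact: hm.
Qed.

Lemma change_mxV c p : dom c p ->
  change_mx (chart_at p) c p *m change_mx c (chart_at p) p = 1%:M.
Proof.
move=> cp; have hp := dom_chart_at p.
by rewrite change_mx_trans // change_mx_id.
Qed.

Lemma chart_mx_unit c p : dom c p ->
  (chart_mx c p \in unitmx) = (fib p \in unitmx).
Proof.
move=> cp; have [uS uT] := mulmx1_unit (change_mxV cp).
by rewrite /chart_mx unitmx_mul uS andbT unitmx_mul uT.
Qed.

Lemma near_det_chart_mx c p : dom c p -> \det (chart_mx c p) != 0 ->
  \forall t \near coord c p, \det (chart_mx c (param c t)) != 0.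
Proof.
move=> cp detp.
have dd : differentiable (fun t => \det ((chart_mx c \o param c) t) : C)
    (coord c p).
  apply: differentiable_det => i j; apply: differentiable_entry.
  exact: differentiable_chart_mx.
apply: (near_neq0 (differentiable_continuous dd)).
by rewrite /= coordK ?inE.
Qed.

Lemma near_unit_fibre p : fib p \in unitmx ->
  \forall q \near p, fib q \in unitmx.
Proof.
move=> up; have [c cp] := chart_cover p.
have detp : \det (chart_mx c p) != 0.
  by rewrite -unitmx_det (chart_mx_unit cp).
have nz := near_det_chart_mx cp detp.
have cc : coord c q @[q --> p] --> coord c p.
  by apply: coord_continuous; rewrite ?inE.
have nq : \forall q \near p, \det (chart_mx c (param c (coord c q))) != 0.
  exact: cc _ nz.
apply: filterS2 (near_dom cp) nq => q cq.
have -> : param c (coord c q) = q by rewrite coordK ?inE.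
by rewrite -unitmx_det (chart_mx_unit cq).
Qed.

Lemma open_unit_fibre : open [set p | fib p \in unitmx].
Proof. by rewrite openE => p /near_unit_fibre. Qed.

Lemma holo_fibre_inv (x : vfield) :
  holo_vfield [set: M] x ->
  holo_vfield [set p | fib p \in unitmx] (fun p => x p *m invmx (fib p)).
Proof.
move=> hx c p up cp.
have dn := near_param cp (near_dom cp).
have un := near_param cp (near_unit_fibre up).
apply: (@near_eq_differentiable _ _ _
  (fun t => (components c x \o param c) t
     *m invmx ((chart_mx c \o param c) t))).
  apply: filterS2 dn un => a ca ua /=; set q := param c a in ca ua *.
  rewrite /components -!mulmxA; congr (_ *m _).
  have uA : chart_mx c q \in unitmx by rewrite chart_mx_unit.
  apply: (canLR (mulmxK uA)); rewrite /chart_mx !mulmxA.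
  rewrite -[X in X *m _ *m _]mulmxA (change_mxV ca) mulmx1.
  by rewrite mulVmx // mul1mx.
apply: differentiable_mulmx; first exact: hx.
apply: differentiable_invmx; last exact: differentiable_chart_mx.
by apply: filterS2 dn un => a ca ua /=; rewrite chart_mx_unit.
Qed.

End MulEndomorphism.

(** * The ring of sections over an open set *)

Section Sections.
Context (R : realType) (n : nat) (M : complex_manifold R n).
Local Notation C := (cplx R).
Local Notation vfield := (M -> 'rV[C]_n).

(** Equality of sections over U ignores the values outside U. Requiring those
    values to be 0 gives each section a unique representative, so that
    equality over U becomes equality. *)
Definition normalized (U : set M) : {pred vfield} :=
  fun x => `[< holo_vfield U x /\ forall p, ~ U p -> x p = 0 >].

Lemma normalized_zmod_closed U : zmod_closed (normalized U).
Proof.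
split=> [|x y /asboolP[hx x0] /asboolP[hy y0]]; apply/asboolP; split.
- exact: holo_vfield0.
- by [].
- by apply: holo_vfieldD => //; exact: holo_vfieldN.
- by move=> p Up; rewrite -[LHS]/(x p - y p) x0 // y0 // subr0.
Qed.

HB.instance Definition _ U := GRing.isZmodClosed.Build vfield (normalized U)
  (normalized_zmod_closed U).

Record secs U := Secs {
  sec_val :> vfield;
  sec_valP : sec_val \in normalized U
}.

HB.instance Definition _ U := [isSub for @sec_val U].
HB.instance Definition _ U := [Choice of secs U by <:].
HB.instance Definition _ U := [SubChoice_isSubZmodule of secs U by <:].

Lemma secs_holo U (a : secs U) : holo_vfield U a.
Proof. by have /asboolP[] := sec_valP a. Qed.

Definition to_section U (a : secs U) : section U := Section (@secs_holo U a).

(** Fields enter the ring of sections through this relation, rather than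
    through a function, because it is compatible with all operations: proofs
    of [rep] compose along the structure of an expression, and they carry the
    holomorphy of the field with them. *)
Definition rep U (x : vfield) (a : secs U) : Prop := eq_on U x a.

Lemma rep_inj U x y (a b : secs U) : rep x a -> rep y b -> eq_on U x y -> a = b.
Proof.
move=> xa yb xy; apply/val_inj/funext => p /=.
have [_ a0] := asboolP _ (sec_valP a); have [_ b0] := asboolP _ (sec_valP b).
case: (pselect (U p)) => Up; last by rewrite a0 // b0.
by rewrite -xa // xy // yb.
Qed.

Lemma rep_eq U x y (a b : secs U) : rep x a -> rep y b -> a = b -> eq_on U x y.
Proof. by move=> xa yb ab p Up; rewrite xa // yb // ab. Qed.

Lemma rep_val U (a : secs U) : rep a a. Proof. by []. Qed.

Lemma rep_holo U x (a : secs U) : open U -> rep x a -> holo_vfield U x.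
Proof.
move=> oU xa; apply: holo_vfield_eq (@secs_holo U a) => // p Up.
by rewrite xa.
Qed.

Lemma rep_exists U x : open U -> holo_vfield U x -> exists a : secs U, rep x a.
Proof.
move=> oU hx; pose y : vfield := fun p => if `[< U p >] then x p else 0.
have xy : eq_on U x y by move=> p Up; rewrite /y asboolT.
have yP : y \in normalized U.
  apply/asboolP; split; first exact: holo_vfield_eq hx.
  by move=> p Up; rewrite /y asboolF.
by exists (Secs yP).
Qed.

Definition sec_class U x (oU : open U) (hx : holo_vfield U x) : secs U :=
  projT1 (cid (rep_exists oU hx)).

Lemma rep_class U x (oU : open U) (hx : holo_vfield U x) :
  rep x (sec_class oU hx).
Proof. exact: projT2 (cid (rep_exists oU hx)). Qed.

Lemma repD U x y (a b : secs U) : rep x a -> rep y b -> rep (x + y) (a + b).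
Proof. by move=> xa yb p Up; rewrite -[LHS]/(x p + y p) xa // yb. Qed.

Lemma repN U x (a : secs U) : rep x a -> rep (- x) (- a).
Proof. by move=> xa p Up; rewrite -[LHS]/(- x p) xa. Qed.

Section SheafOp.
Context (W : set M) (B : vfield -> vfield -> vfield) (B_op : sheaf_op W B).
Context (U : set M) (WU : opens W U).

Lemma sheaf_op_holo x y :
  holo_vfield U x -> holo_vfield U y -> holo_vfield U (B x y).
Proof.
move=> hx hy; have [h _] := B_op WU.
exact: h (Section hx) (Section hy).
Qed.

Definition op_on (a b : secs U) : secs U :=
  sec_class (proj1 WU) (sheaf_op_holo (@secs_holo U a) (@secs_holo U b)).

Lemma rep_op x y a b : rep x a -> rep y b -> rep (B x y) (op_on a b).
Proof.
move=> xa yb p Up; have oU := proj1 WU; rewrite -[RHS]rep_class //.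
have [_ h] := B_op WU.
exact: (h (Section (rep_holo oU xa)) (to_section a)
  (Section (rep_holo oU yb)) (to_section b)).
Qed.

End SheafOp.

Lemma sheaf_op_rep W (B : vfield -> vfield -> vfield) :
  (forall U, opens W U -> exists f : secs U -> secs U -> secs U,
    forall x y a b, rep x a -> rep y b -> rep (B x y) (f a b)) ->
  sheaf_op W B.
Proof.
move=> Brep U WU; have [f fP] := Brep U WU; have oU := proj1 WU.
have cl (x : section U) := rep_class oU (@section_holo _ _ _ _ x).
split=> [x y|x x' y y' xx' yy'].
  exact: rep_holo oU (fP _ _ _ _ (cl x) (cl y)).
have rx : rep x (sec_class oU (@section_holo _ _ _ _ x')).
  by move=> p Up; rewrite xx' // cl.
have ry : rep y (sec_class oU (@section_holo _ _ _ _ y')).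
  by move=> p Up; rewrite yy' // cl.
exact: rep_eq (fP _ _ _ _ rx ry) (fP _ _ _ _ (cl x') (cl y')) _.
Qed.

Section Ring.
Context (W : set M) (m : vfield -> vfield -> vfield) (e : vfield).
Context (m_cam : comm_assoc_mul W m e).
Context (U : set M) (WU : opens W U).

Local Notation mulS := (op_on (mul_sheaf (cam_mul m_cam)) WU).

Let repM x y a b : rep x a -> rep y b -> rep (m x y) (mulS a b).
Proof. exact: rep_op. Qed.

Lemma unit_holo : holo_vfield U e.
Proof. exact: holo_vfield_sub (proj2 WU) (cam_unit_holo m_cam). Qed.

Definition sec_one : secs U := sec_class (proj1 WU) unit_holo.

Lemma rep_one : rep e sec_one. Proof. exact: rep_class. Qed.

Lemma sec_mulA : associative mulS.
Proof.
move=> a b c; have val := @rep_val U.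
apply: (rep_inj (repM (val a) (repM (val b) (val c)))
                (repM (repM (val a) (val b)) (val c))) => p Up.
by rewrite (cam_assoc m_cam WU (to_section a) (to_section b) (to_section c) Up).
Qed.

Lemma sec_mulC : commutative mulS.
Proof.
move=> a b; have val := @rep_val U.
apply: (rep_inj (repM (val a) (val b)) (repM (val b) (val a))) => p Up.
exact: (cam_comm m_cam WU (to_section a) (to_section b) Up).
Qed.

Lemma sec_mul1 : left_id sec_one mulS.
Proof.
move=> a; apply: (rep_inj (repM rep_one (@rep_val U a)) (@rep_val U a)) => p Up.
exact: (cam_unit m_cam WU (to_section a) Up).
Qed.

Lemma scale1_field (x : vfield) : scale_field (fun=> 1) x = x.
Proof. by apply/funext => p; rewrite /scale_field scale1r. Qed.

Lemma sec_mulDl : left_distributive mulS +%R.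
Proof.
move=> a b c; have val := @rep_val U.
apply: (rep_inj (repM (repD (val a) (val b)) (val c))
  (repD (repM (val a) (val c)) (repM (val b) (val c)))) => p Up.
have := mul_linearl (cam_mul m_cam) WU (to_section a) (to_section b)
  (to_section c) (@holo_fun_cst _ _ M U 1) Up.
by rewrite !scale1_field.
Qed.

(** The two proofs are arguments so that the ring structure can be inferred
    from the type. *)
Definition section_ring of comm_assoc_mul W m e & opens W U : Type := secs U.

HB.instance Definition _ := GRing.Zmodule.on (section_ring m_cam WU).
HB.instance Definition _ := GRing.Zmodule_isComPzRing.Build
  (section_ring m_cam WU) sec_mulA sec_mulC sec_mul1 sec_mulDl.

End Ring.
End Sections.

(** * The Saito ring of sections *)

Section SaitoSections.
Context (R : realType) (n : nat) (M : complex_manifold R n).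
Local Notation C := (cplx R).
Local Notation vfield := (M -> 'rV[C]_n).
Context (W : set M) (nabla m : vfield -> vfield -> vfield) (e E : vfield).
Hypothesis S : saito_structure W nabla m e E.
Context (U : set M) (WU : opens W U).

Local Notation A := (section_ring (saito_mul S) WU).
Let oU : open U := proj1 WU.
Let nabla_conn := tff_connection (saito_nabla S).

Definition nabla_on : A -> A -> A := op_on (conn_sheaf nabla_conn) WU.

Lemma rep_nabla x y (a b : A) :
  rep x a -> rep y b -> rep (nabla x y) (nabla_on a b).
Proof. exact: rep_op. Qed.

Lemma rep_mulA x y (a b : A) : rep x a -> rep y b -> rep (m x y) (a * b).
Proof. exact: rep_op. Qed.

Lemma rep_unitA : rep e (1 : A). Proof. exact: rep_one. Qed.

(* [repD] and [repN] speak of the group of sections; the rules used by proof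
   search must mention the ring operations. *)
Lemma repDA x y (a b : A) : rep x a -> rep y b -> rep (x + y) (a + b).
Proof. exact: repD. Qed.

Lemma repNA x (a : A) : rep x a -> rep (- x) (- a).
Proof. exact: repN. Qed.

Lemma rep_eqA x y (a b : A) : rep x a -> rep y b -> a = b -> eq_on U x y.
Proof. exact: rep_eq. Qed.

Lemma rep0A : rep 0 (0 : A). Proof. by []. Qed.

Lemma rep0A' : rep (@null_field _ _ M) (0 : A). Proof. by []. Qed.

Lemma rep_to_section (a : A) : rep (to_section a) a. Proof. by []. Qed.

Lemma rep_bracket x y (a b : A) : rep x a -> rep y b ->
  rep (bracket x y) (nabla_on a b - nabla_on b a).
Proof.
move=> xa yb p Up.
have := tff_torsion_free (saito_nabla S) WU (Section (rep_holo oU xa))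
  (Section (rep_holo oU yb)) Up.
move=> <-; exact: (repDA (rep_nabla xa yb) (repNA (rep_nabla yb xa)) Up).
Qed.

Definition class_of (x : section U) : A :=
  sec_class oU (@section_holo _ _ _ _ x).

Lemma rep_class_of (x : section U) : rep x (class_of x).
Proof. exact: rep_class. Qed.

Hint Resolve rep_nabla rep_mulA rep_unitA repDA repNA rep0A rep0A'
  rep_to_section rep_bracket rep_class_of : rep.

(** A function f enters the ring as the section f e, since f x = (f e) * x. *)
Definition fun_class f (hf : holo_fun U f) : A :=
  sec_class oU (holo_vfield_scale hf (unit_holo (saito_mul S) WU)).

Lemma rep_scale f (hf : holo_fun U f) x (a : A) :
  rep x a -> rep (scale_field f x) (fun_class hf * a).
Proof.
move=> xa; pose phi := fun_class hf.
have fe : rep (scale_field f e) phi by exact: rep_class.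
have he := unit_holo (saito_mul S) WU.
have h0 := @holo_vfield0 _ _ M U.
have H := mul_linearl (cam_mul (saito_mul S)) WU (Section he) (Section h0)
  (Section (rep_holo oU xa)) hf.
have r0 : rep (m 0 x) (0 : A).
  by rewrite -[0 : A](mul0r a); eauto with rep.
have H1 := cam_unit (saito_mul S) WU (Section (rep_holo oU xa)).
have R1 : rep (m (scale_field f e + 0) x) (phi * a).
  by rewrite -[phi]addr0; eauto with rep.
move=> p Up; rewrite -[RHS](R1 p Up) [RHS](H p Up).
by rewrite -[RHS]/(scale_field f (m e x) p + m 0 x p) (r0 p Up) addr0
  /scale_field (H1 p Up).
Qed.

Lemma nabla_on_linear f (hf : holo_fun U f) (a a' b : A) :
  nabla_on (fun_class hf * a + a') b =
  fun_class hf * nabla_on a b + nabla_on a' b.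
Proof.
have rs := rep_scale hf.
apply: (rep_inj _ _ (conn_linear nabla_conn WU (to_section a) (to_section a')
  (to_section b) hf)); eauto 20 with rep.
Qed.

(** Leibniz' rule, as the derivative of a constant function is 0. *)
Lemma nabla_on_const k (hk : holo_fun U (fun=> k)) (a b : A) :
  nabla_on a (fun_class hk * b) = fun_class hk * nabla_on a b.
Proof.
have rs := rep_scale hk.
have := conn_leibniz nabla_conn WU (to_section a) (to_section b) hk.
have -> : scale_field (derivation (to_section a) (fun=> k)) (to_section b) = 0.
  apply/funext => p; rewrite /scale_field /derivation.
  by rewrite derive_cst scale0r.
by rewrite add0r => H; apply: (rep_inj _ _ H); eauto 20 with rep.
Qed.

Lemma nabla_on_Bl (a a' b : A) :
  nabla_on (a - a') b = nabla_on a b - nabla_on a' b.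
Proof.
pose k := @holo_fun_cst _ _ M U (-1).
have kE (c : A) : fun_class k * c = - c.
  have H : eq_on U (scale_field (fun=> -1) (to_section c))
      (- (to_section c : vfield)).
    by move=> p Up; rewrite /scale_field scaleN1r.
  by apply: (rep_inj (rep_scale k (rep_to_section c)) _ H); eauto with rep.
by rewrite addrC -kE nabla_on_linear kE addrC.
Qed.

Lemma nabla_on_Br (a b b' : A) :
  nabla_on a (b - b') = nabla_on a b - nabla_on a b'.
Proof.
have nD c d : nabla_on a (c + d) = nabla_on a c + nabla_on a d.
  by apply: (rep_inj _ _ (conn_additive nabla_conn WU (to_section a)
    (to_section c) (to_section d))); eauto 20 with rep.
by apply/eqP; rewrite eq_sym subr_eq -nD subrK.
Qed.

Lemma euler_holo : holo_vfield U E.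
Proof. exact: holo_vfield_sub (proj2 WU) (saito_euler_holo S). Qed.

Definition euler_section : A := sec_class oU euler_holo.

Lemma rep_euler : rep E euler_section. Proof. exact: rep_class. Qed.

Hint Resolve rep_euler : rep.

Lemma section_saito_ring : saito_ring nabla_on euler_section.
Proof.
split; [exact: nabla_on_Bl | exact: nabla_on_Br | | | | |].
- move=> a b c; apply: (rep_inj _ _ (tff_flat (saito_nabla S) WU (to_section a)
    (to_section b) (to_section c))); eauto 20 with rep.
- move=> a b c; apply: (rep_inj _ _ (saito_SS1 S WU (to_section a)
    (to_section b) (to_section c))); eauto 20 with rep.
- move=> a b; apply: (rep_inj _ _ (saito_SS2 S WU (to_section a)
    (to_section b))); eauto 20 with rep.
- move=> a; apply: (rep_inj _ _ (saito_SS3 S WU (to_section a)));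
    eauto 20 with rep.
- move=> a b; apply/eqP; rewrite -subr_eq0; apply/eqP.
  apply: (rep_inj _ _ (saito_SS4 S WU (to_section a) (to_section b)));
    eauto 20 with rep.
Qed.

Lemma nabla_on_scale f (hf : holo_fun U f) (a b : A) :
  nabla_on (fun_class hf * a) b = fun_class hf * nabla_on a b.
Proof.
rewrite -[fun_class hf * a]addr0 nabla_on_linear.
by rewrite (nabla0l section_saito_ring) addr0.
Qed.

End SaitoSections.

(** * The bi-flat structure *)

Section Restriction.
Context (R : realType) (n : nat) (M : complex_manifold R n).
Local Notation C := (cplx R).
Local Notation vfield := (M -> 'rV[C]_n).

Lemma saito_restrict (W W' : set M) nabla m (e E : vfield) :
  open_submanifold W' -> W' `<=` W ->
  saito_structure W nabla m e E -> saito_structure W' nabla m e E.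
Proof.
move=> oW' sub.
move=> [oW [[n1 n2 n3 n4] tf fl] [[m1 m2 m3] ma mc eh me] Eh s1 s2 s3 s4].
have oo U : opens W' U -> opens W U.
  by move=> [oU UW']; split => //; exact: subset_trans sub.
split => //.
- split; [split|..].
  + by move=> U /oo; exact: n1.
  + by move=> U /oo; exact: n2.
  + by move=> U /oo; exact: n3.
  + by move=> U /oo; exact: n4.
  + by move=> U /oo; exact: tf.
  + by move=> U /oo; exact: fl.
- split; [split|..].
  + by move=> U /oo; exact: m1.
  + by move=> U /oo; exact: m2.
  + by move=> U /oo; exact: m3.
  + by move=> U /oo; exact: ma.
  + by move=> U /oo; exact: mc.
  + exact: holo_vfield_sub eh.
  + by move=> U /oo; exact: me.
- exact: holo_vfield_sub Eh.
- by move=> U /oo; exact: s1.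
- by move=> U /oo; exact: s2.
- by move=> U /oo; exact: s3.
- by move=> U /oo; exact: s4.
Qed.

End Restriction.

Section Biflat.
Context (R : realType) (n : nat) (M : complex_manifold R n).
Local Notation C := (cplx R).
Local Notation vfield := (M -> 'rV[C]_n).
Context (W : set M) (nabla m : vfield -> vfield -> vfield) (e E : vfield).
Hypothesis S : saito_structure W nabla m e E.
Context (lambda : C).
Local Notation F := (shift_field E e lambda).
Context (G : vfield) (star : vfield -> vfield -> vfield).
Hypothesis G_holo : holo_vfield W G.
Hypothesis FG : eq_on W (m F G) e.
Hypothesis starE : forall U, opens W U -> forall x y : section U,
  eq_on U (star x y) (m G (m x y)).

Let nabla' (x y : vfield) : vfield := nabla x y - nabla (star x y) E.

Section OnU.
Context (U : set M) (WU : opens W U).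
Local Notation A := (section_ring (saito_mul S) WU).
Local Notation nablaA := (@nabla_on _ _ _ _ _ _ _ _ S _ WU).
Local Notation eA := (euler_section S WU).

Definition shift_const : A := fun_class S WU (@holo_fun_cst _ _ M U lambda).
Local Notation FA := (eA - shift_const).

(** The function lambda acts as multiplication by lambda e, which is thus the
    class of its product with the unit. *)
Lemma rep_shift : rep F (FA : A).
Proof.
have H := rep_scale (WU := WU) (S := S) (@holo_fun_cst _ _ M U lambda)
  (rep_unitA S WU).
rewrite mulr1 in H.
exact: (repDA (rep_euler S WU) (repNA H)).
Qed.

Definition inverse_class : A :=
  sec_class (proj1 WU) (holo_vfield_sub (proj2 WU) G_holo).
Local Notation GA := inverse_class.

Lemma rep_inverse : rep G (GA : A). Proof. exact: rep_class. Qed.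

Lemma shift_inverse : FA * GA = 1.
Proof.
apply: (rep_inj (rep_mulA rep_shift rep_inverse) (rep_unitA S WU)) => p Up.
by apply: FG; exact: (proj2 WU).
Qed.

Lemma shift_saito_ring : saito_ring nablaA FA.
Proof.
apply: saito_ring_shift (section_saito_ring S WU) _ => a b.
exact: nabla_on_const.
Qed.

Lemma rep_star x y (a b : A) :
  rep x a -> rep y b -> rep (star x y) (GA * (a * b)).
Proof.
move=> xa yb p Up; have oU := proj1 WU.
rewrite (starE WU (Section (rep_holo oU xa)) (Section (rep_holo oU yb)) Up).
exact: (rep_mulA rep_inverse (rep_mulA xa yb) Up).
Qed.

Definition nablaA' (a b : A) : A := nabla_star nablaA FA GA a b.

(** D is unchanged when E is replaced by E - lambda e. *)
Lemma rep_nabla' x y (a b : A) :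
  rep x a -> rep y b -> rep (nabla' x y) (nablaA' a b).
Proof.
move=> xa yb; have nF c : nablaA c FA = nablaA c eA.
  apply: nabla_shift (section_saito_ring S WU) _ _ => a' b'.
  exact: nabla_on_const.
rewrite /nablaA' /nabla_star nF.
exact: (repDA (rep_nabla xa yb)
  (repNA (rep_nabla (rep_star xa yb) (rep_euler S WU)))).
Qed.

End OnU.

(** Finds the class of an expression by recursion on its syntax; the match is
    syntactic, so that nabla' is not unfolded to a difference. *)
Ltac solve_rep :=
  lazymatch goal with
  | |- rep (nabla' _ _) _ => eapply rep_nabla'; solve_rep
  | |- rep (star _ _) _ => eapply rep_star; solve_rep
  | |- rep (nabla _ _) _ => eapply rep_nabla; solve_rep
  | |- rep (m _ _) _ => eapply rep_mulA; solve_rep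
  | |- rep (bracket _ _) _ => eapply rep_bracket; solve_rep
  | hf : holo_fun _ ?f |- rep (scale_field ?f _) _ =>
      eapply (rep_scale hf); solve_rep
  | |- rep (_ + _) _ => eapply repDA; solve_rep
  | |- rep (- _) _ => eapply repNA; solve_rep
  | |- rep F _ => eapply rep_shift
  | |- rep G _ => eapply rep_inverse
  | |- rep E _ => eapply rep_euler
  | |- rep e _ => eapply rep_unitA
  | |- rep (@null_field _ _ _) _ => eapply rep0A'
  | |- rep (section_fun (to_section _)) _ => eapply rep_val
  | |- rep (section_fun _) _ => eapply rep_class_of
  end.

Lemma nabla'_connection : connection W nabla'.
Proof.
split.
- apply: sheaf_op_rep => U WU; exists (@nablaA' U WU) => x y a b.
  exact: rep_nabla'.
- move=> U WU f x x' y hf.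
  apply: (rep_eqA (S := S) (WU := WU)); [solve_rep..|].
  rewrite /nablaA' /nabla_star !mulrDl !mulrDr nabla_on_linear.
  rewrite mulrA mulrCA -!mulrA nabla_on_linear.
  ring.
- move=> U WU x y y'.
  apply: (rep_eqA (S := S) (WU := WU)); [solve_rep..|].
  have SS := shift_saito_ring WU.
  rewrite /nablaA' /nabla_star !mulrDr (nablaDr SS) (nablaDl SS).
  ring.
- move=> U WU f x y hf p Up.
  have starZ : eq_on U (nabla (star x (scale_field f y)) E)
                   (scale_field f (nabla (star x y) E)).
    apply: (rep_eqA (S := S) (WU := WU)); [solve_rep..|].
    by rewrite -nabla_on_scale; congr (nabla_on _ _); ring.
  have nablaL := conn_leibniz (tff_connection (saito_nabla S)) WU x y hf.
  rewrite -[LHS]/(nabla x (scale_field f y) p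
    - nabla (star x (scale_field f y)) E p) (starZ p Up) (nablaL p Up).
  by rewrite -[LHS]addrA -[RHS]/(_ + (f p *: (_ - _))) scalerBr.
Qed.

(** The fibrewise inverse of U_lambda matters only through the section G: once
    star is multiplication by G, each axiom is an equation in the ring of
    sections. *)
Theorem biflat_of_inverse : biflat_F_manifold W nabla nabla' m star e F.
Proof.
split.
- exact: saito_submanifold S.
- exact: saito_nabla S.
- split; first exact: nabla'_connection.
  + move=> U WU x y.
    apply: (rep_eqA (S := S) (WU := WU)); [solve_rep..|].
    rewrite /nablaA' /nabla_star [class_of S WU y * _]mulrC; ring.
  + move=> U WU x y z.
    apply: (rep_eqA (S := S) (WU := WU)); [solve_rep..|].
    exact: star_flat (shift_saito_ring WU) (shift_inverse WU) _ _ _.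
- exact: saito_mul S.
- split; first split.
  + apply: sheaf_op_rep => U WU.
    exists (fun a b => inverse_class WU
     * (a * b : section_ring (saito_mul S) WU)).
    exact: rep_star.
  + move=> U WU f x x' y hf.
    by apply: (rep_eqA (S := S) (WU := WU)); [solve_rep..|ring].
  + move=> U WU f x y y' hf.
    by apply: (rep_eqA (S := S) (WU := WU)); [solve_rep..|ring].
  + move=> U WU x y z.
    by apply: (rep_eqA (S := S) (WU := WU)); [solve_rep..|ring].
  + move=> U WU x y.
    by apply: (rep_eqA (S := S) (WU := WU)); [solve_rep..|ring].
  + have WW : opens W W by split => //; exact: (proj1 (saito_submanifold S)).
    exact: rep_holo (proj1 WW) (rep_shift WW).
  + move=> U WU x.
    apply: (rep_eqA (S := S) (WU := WU)); [solve_rep..|].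
    by rewrite mulrA [_ * (_ - _)]mulrC shift_inverse mul1r.
- exact: saito_SS1 S.
- move=> U WU x y.
  apply: (rep_eqA (S := S) (WU := WU)); [solve_rep..|].
  exact: ring_SS2 (shift_saito_ring WU) _ _.
- exact: saito_SS3 S.
- move=> U WU x y z.
  apply: (rep_eqA (S := S) (WU := WU)); [solve_rep..|].
  exact: star_SS1 (shift_saito_ring WU) (shift_inverse WU) _ _ _.
- move=> U WU x.
  apply: (rep_eqA (S := S) (WU := WU)); [solve_rep..|].
  rewrite /nablaA' /nabla_star [_ * (_ - _)]mulrC mulrA.
  by rewrite [_ * (_ - _)]mulrC shift_inverse mul1r subrr.
- move=> U WU; have GF := shift_inverse WU; split.
    move=> x x' xx'; apply: (rep_eqA (S := S) (WU := WU)); [solve_rep..|].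
    have Fxx' : (euler_section S WU - shift_const WU) * class_of S WU x =
        (euler_section S WU - shift_const WU) * class_of S WU x'.
      by apply: (rep_inj _ _ xx'); solve_rep.
    rewrite -[LHS]mul1r -[RHS]mul1r -GF ![_ * inverse_class WU]mulrC -!mulrA.
    by rewrite Fxx'.
  move=> y.
  exists (to_section (inverse_class WU * class_of S WU y)).
  apply: (rep_eqA (S := S) (WU := WU)); [solve_rep..|].
  by rewrite mulrA GF mul1r.
- move=> U WU x y.
  apply: (rep_eqA (S := S) (WU := WU)); [solve_rep..|].
  by rewrite mulrA shift_inverse mul1r.
- move=> U WU x y z.
  apply: (rep_eqA (S := S) (WU := WU)); [solve_rep..|].
  rewrite /nablaA' /nabla_star [class_of S WU y * (_ * _)]mulrCA; ring.
Qed.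

End Biflat.

Theorem lemma4p3 (R : realType) (n : nat) (M : complex_manifold R n)
    (nabla mul : (M -> 'rV[cplx R]_n) -> (M -> 'rV[cplx R]_n) -> (M -> 'rV[cplx R]_n))
    (e E : M -> 'rV[cplx R]_n)
    (lambda : cplx R) :
  saito_structure [set: M] nabla mul e E ->
  M_lambda mul e E lambda !=set0 ->
  biflat_F_manifold (M_lambda mul e E lambda)
    nabla (nabla_lambda nabla mul e E lambda)
    mul (star_lambda mul e E lambda)
    e (shift_field E e lambda).
Proof.
move=> S W0; have mulM := cam_mul (saito_mul S).
have eM := cam_unit_holo (saito_mul S).
have FM := holo_shift_field lambda (saito_euler_holo S) eM.
have oW : open (M_lambda mul e E lambda) := open_unit_fibre mulM FM.
have SW : saito_structure (M_lambda mul e E lambda) nabla mul e E.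
  exact: saito_restrict (conj oW W0) _ S.
pose G p := e p *m invmx (fibre_mx (U_lambda mul e E lambda) p).
have GW : holo_vfield (M_lambda mul e E lambda) G.
  exact: (holo_fibre_inv mulM FM eM).
have FG : eq_on (M_lambda mul e E lambda)
    (mul (shift_field E e lambda) G) e.
  by move=> p Wp; rewrite [LHS](mul_fibre mulM FM oW GW Wp) mulmxKV.
apply: (biflat_of_inverse SW GW FG) => U WU x y p Up.
have rep_x := rep_class_of SW WU x; have rep_y := rep_class_of SW WU y.
have rep_G := rep_inverse SW GW WU.
have rep_GM := rep_mulA rep_G (rep_mulA rep_x rep_y).
have oU := proj1 WU.
have F_GM : eq_on U
    (mul (shift_field E e lambda) (mul G (mul x y))) (mul x y).
  apply: (rep_eqA (rep_mulA (rep_shift SW lambda WU) rep_GM)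
                  (rep_mulA rep_x rep_y)).
  by rewrite mulrA (shift_inverse SW GW FG WU) mul1r.
have GM_holo := rep_holo oU rep_GM.
rewrite /star_lambda -(F_GM p Up).
rewrite [X in X *m _](mul_fibre mulM FM oU GM_holo Up).
by rewrite mulmxK //; exact: (proj2 WU).
Qed.
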